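(* Let $\left(\frac pq,\frac rq\right)$ be the interior rational pair with representation $([\alpha_0,\ldots,\alpha_k],[a_1,\ldots,a_n])$ and let $\omega=1^{\alpha_0}0\cdots 1^{\alpha_{k-1}}01^{\alpha_k-1}\in\{0,1\}^*$, so that $\left(\frac pq,\frac rq\right)\in\phi_\omega(\ell)$. Then: (i) $\phi_\omega\left(\frac12,\frac12\right)=\left(\frac12,\frac12\right)L^{\alpha_0}I\cdots L^{\alpha_{k-1}}IL^{\alpha_k-1}$; (ii) $\left(\frac pq,\frac rq\right)=\phi_\omega\left(\frac12,\frac12\right)IL^{a_1-1}R^{a_2}\cdots L^{a_{n-1}}R^{a_n-1}$ if $n$ is even, and $\left(\frac pq,\frac rq\right)=\phi_\omega\left(\frac12,\frac12\right)IL^{a_1-1}R^{a_2}\cdots R^{a_{n-1}}L^{a_n-1}$ if $n$ is odd. Hence $$\left(\frac pq,\frac rq\right)=\begin{cases}\left(\frac12,\frac12\right)L^{\alpha_0}I\cdots L^{\alpha_{k-1}}IL^{\alpha_k-1}IL^{a_1-1}R^{a_2}\cdots L^{a_{n-1}}R^{a_n-1} & \text{if } n \text{ is even},\\ \left(\frac12,\frac12\right)L^{\alpha_0}I\cdots L^{\alpha_{k-1}}IL^{\alpha_k-1}IL^{a_1-1}R^{a_2}\cdots R^{a_{n-1}}L^{a_n-1} & \text{if } n \text{ is odd}.\end{cases}$$ (When $n=1$ the block $L^{a_1-1}R^{a_2}\cdots R^{a_{n-1}}L^{a_n-1}$ is to be read as $L^{a_1-2}$.)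
   Context: **Triangle and maps.** $\triangle=\{(x,y)\in\mathbb R^2: 1\ge x\ge y>0\}$, $\overline\triangle=\{1\ge x\ge y\ge 0\}$, $\Sigma=\overline\triangle\cap\{x=y\}$, $\Lambda=\{(x,0):0\le x\le1\}$, $\Upsilon=\overline\triangle\cap\{x=1\}$. For $k\ge0$, $\triangle_k=\{(x,y)\in\triangle: 1-x-ky\ge0>1-x-(k+1)y\}$; then $\overline\triangle$ is the disjoint union of $\Lambda$ and the $\triangle_k$. The Triangle Map is $T:\triangle\to\overline\triangle$, $T(x,y)=\left(\frac yx,\frac{1-x-ky}{x}\right)$ for $(x,y)\in\triangle_k$. The maps $\phi_0(x,y)=\left(\frac1{1+y},\frac x{1+y}\right)$ and $\phi_1(x,y)=\left(\frac x{1+y},\frac y{1+y}\right)$ are considered on all of $\overline\triangle$, and $\phi_2:\Sigma\to\Lambda$ is $\phi_2(x,x)=(x,0)$. For a finite word $\omega=\omega_0\cdots\omega_{n-1}\in\{0,1\}^*$, $\phi_\omega=\phi_{\omega_0}\circ\cdots\circ\phi_{\omega_{n-1}}$ (identity for the empty word). $\ell$ is the open segment joining $(1,0)$ and $\left(\frac12,\frac12\right)$; note $\ell=\{\phi_1\phi_0\phi_2(\xi,\xi):0<\xi<1\}$. **Representation.** A point of $\triangle$ has finite triangle sequence $[\alpha_0,\ldots,\alpha_k]$ if $T^j(x,y)\in\triangle_{\alpha_j}$ for $0\le j\le k$ and $T^{k+1}(x,y)\in\Lambda$. Every rational pair in the interior of $\overline\triangle$ has a finite triangle sequence, with $\alpha_k\ge1$,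 and there is a unique $\xi\in(0,1)$, which is rational, with $\left(\frac pq,\frac rq\right)=\phi_1^{\alpha_0}\phi_0\cdots\phi_1^{\alpha_k}\phi_0\phi_2(\xi,\xi)$. Its representation is $([\alpha_0,\ldots,\alpha_k],[a_1,\ldots,a_n])$, where $[a_1,\ldots,a_n]$ is the continued fraction expansion of $\xi$, with $a_n>1$ when $n>1$. **Mediant.** $\left(\frac pq,\frac rq\right)\oplus\left(\frac{p'}{q'},\frac{r'}{q'}\right)=\left(\frac{p+p'}{q+q'},\frac{r+r'}{q+q'}\right)$, where each pair is written with its least common (positive) denominator. **Parents and the right actions $L$, $R$, $I$.** A rational number $\frac ab\in(0,1)$ in lowest terms is in a unique way $\frac{l+r}{m+s}$ with $\frac lm<\frac rs$ fractions of non-negative integers in lowest terms, $m,s\ge1$, $rm-ls=1$, $a=l+r$, $b=m+s$; $\frac lm$ and $\frac rs$ are its left and right Farey parents. Every rational pair in $\overline\triangle$ different from the vertices lies on exactly one of the following segments, each oriented by its parameter $\xi\in(0,1)$: $\Sigma$ with $\theta(\xi)=(\xi,\xi)$; $\Lambda$ with $\theta(\xi)=(\xi,0)$; $\Upsilon$ with $\theta(\xi)=(1,\xi)$; $\phi_\omega(\ell)$, $\omega\in\{0,1\}^*$, with $\theta(\xi)=\phi_\omega\phi_1\phi_0\phi_2(\xi,\xi)$. The left (right) parent of $\theta\left(\frac ab\right)$ is $\theta\left(\frac lm\right)$ (resp. $\theta\left(\frac rs\right)$), where $\frac lm,\frac rs$ are the left and right Farey parents of $\frac ab$ and $\theta$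 is extended to $[0,1]$ by the same formula. For such a rational pair $X$, $XL$ is the mediant of $X$ with its left parent and $XR$ is the mediant of $X$ with its right parent. For $\omega\in\{0,1\}^*$, $\phi_\omega\left(\frac12,\frac12\right)I:=\phi_\omega\left(\frac12,\frac12\right)\oplus\phi_\omega(1,0)=\phi_\omega\left(\frac23,\frac13\right)$. Words in $L,R,I$ act on the right, letters being applied from left to right. *)

(* Defs.v *)
(* Plane points are pairs of rationals: every point in the statement is a
   rational pair, and T, the maps phi_i and their inverses preserve rationality.
   Binary words are sequences of booleans, with true for 1 and false for 0. *)
From mathcomp Require Import all_boot all_order all_algebra.
Set Implicit Arguments.
Unset Strict Implicit.
Unset Printing Implicit Defensive.
Import Order.TTheory GRing.Theory Num.Theory.
Local Open Scope ring_scope.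

Definition point : Type := (rat * rat)%type.

Definition triangle (P : point) : bool :=
  [&& P.1 <= 1, P.2 <= P.1 & 0 < P.2].

Definition triangle_interior (P : point) : bool :=
  [&& P.1 < 1, P.2 < P.1 & 0 < P.2].

Definition Lambda (P : point) : bool := [&& 0 <= P.1, P.1 <= 1 & P.2 == 0].

Definition triangle_part (k : nat) (P : point) : bool :=
  [&& triangle P, 0 <= 1 - P.1 - k%:R * P.2 & 1 - P.1 - k.+1%:R * P.2 < 0].

Definition triangle_index (P : point) : nat := Num.truncn ((1 - P.1) / P.2).

Lemma triangle_partE (k : nat) (P : point) :
  triangle P -> triangle_part k P = (triangle_index P == k).
Proof.
move=> tP; have /and3P[x1 yx y0] := tP; rewrite /triangle_part tP /=.
have q0 : 0 <= (1 - P.1) / P.2 by rewrite divr_ge0 ?subr_ge0 // ltW.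
by rewrite /triangle_index truncn_eq // subr_ge0 subr_lt0 ler_pdivlMr ?ltr_pdivrMr.
Qed.

(* Only meaningful on the triangle, where triangle_partE applies. *)
Definition triangle_map (P : point) : point :=
  (P.2 / P.1, (1 - P.1 - (triangle_index P)%:R * P.2) / P.1).

Definition triangle_sequence (P : point) (alpha : seq nat) : Prop :=
  [/\ (0 < size alpha)%N,
      forall j, (j < size alpha)%N ->
        triangle_part (nth 0%N alpha j) (iter j triangle_map P)
    & Lambda (iter (size alpha) triangle_map P)].

Definition phi (b : bool) (P : point) : point :=
  if b then (P.1 / (1 + P.2), P.2 / (1 + P.2))
  else (1 / (1 + P.2), P.1 / (1 + P.2)).

(* Only used on the diagonal x = y. *)
Definition phi2 (P : point) : point := (P.1, 0).

Definition phi_word (w : seq bool) (P : point) : point := foldr phi P w.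

Definition ell (P : point) : Prop :=
  exists2 t : rat, 0 < t < 1
    & P = ((1 - t) * 1 + t * (1 / 2), (1 - t) * 0 + t * (1 / 2)).

Fixpoint cf_value (a : seq nat) : rat :=
  if a is m :: s then 1 / (m%:R + cf_value s) else 0.

Definition continued_fraction (xi : rat) (a : seq nat) : Prop :=
  [/\ (0 < size a)%N, all (leq 1) a, ((1 < size a)%N -> (1 < last 0%N a)%N)
    & xi = cf_value a].

(* x^(m_0) y x^(m_1) y ... x^(m_k) y *)
Definition full_word (T : Type) (x y : T) (s : seq nat) : seq T :=
  flatten [seq rcons (nseq m x) y | m <- s].

(* x^(m_0) y ... x^(m_(k-1)) y x^(m_k - 1) *)
Definition prefix_word (T : Type) (x y : T) (s : seq nat) : seq T :=
  full_word x y (take (size s).-1 s) ++ nseq (last 0%N s).-1 x.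

Definition representation (P : point) (alpha a : seq nat) : Prop :=
  triangle_sequence P alpha /\
  exists xi : rat,
    [/\ 0 < xi < 1,
        P = phi_word (full_word true false alpha) (phi2 (xi, xi))
      & continued_fraction xi a].

Definition common_denom (P : point) : nat :=
  lcmn `|denq P.1| `|denq P.2|.

(* P.1 * q and P.2 * q are the numerators over q := common_denom P. *)
Definition mediant (P Q : point) : point :=
  let q : rat := (common_denom P)%:R in
  let q' : rat := (common_denom Q)%:R in
  ((P.1 * q + Q.1 * q') / (q + q'), (P.2 * q + Q.2 * q') / (q + q')).

Definition farey_parents (xi left right : rat) : Prop :=
  exists l m r s : nat,
    [/\ [/\ (0 < m)%N, (0 < s)%N, coprime l m & coprime r s],
        [/\ left = l%:R / m%:R, right = r%:R / s%:R & left < right],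
        (r * m - l * s = 1)%N
      & numq xi = Posz (l + r) /\ denq xi = Posz (m + s)].

Inductive segment : Type := SSigma | SLambda | SUpsilon | SEll of seq bool.

Definition theta (S : segment) (xi : rat) : point :=
  match S with
  | SSigma => (xi, xi)
  | SLambda => (xi, 0)
  | SUpsilon => (1, xi)
  | SEll w => phi_word w (phi true (phi false (phi2 (xi, xi))))
  end.

Definition parents (X left right : point) : Prop :=
  exists (S : segment) (xi l r : rat),
    [/\ 0 < xi < 1, X = theta S xi, farey_parents xi l r,
        left = theta S l & right = theta S r].

Inductive letter : Type := L | R | I.

(* act X c Y: Y is a value of the partial operation X c. *)
Definition act (X : point) (c : letter) (Y : point) : Prop :=
  match c with
  | L => exists P Q, parents X P Q /\ Y = mediant X P
  | R => exists P Q, parents X P Q /\ Y = mediant X Q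
  | I => exists2 w : seq bool, X = phi_word w (1 / 2, 1 / 2)
           & Y = mediant X (phi_word w (1, 0))
  end.

Fixpoint act_word (X : point) (w : seq letter) (Y : point) : Prop :=
  if w is c :: w' then exists2 Z, act X c Z & act_word Z w' Y else Y = X.

(* X w is defined, and Y is its one and only value. *)
Definition act_word_eq (X : point) (w : seq letter) (Y : point) : Prop :=
  forall Z, act_word X w Z <-> Z = Y.

(* L^(a_1 - 1) R^(a_2) L^(a_3) ... C^(a_n - 1), where C is R for n even and L
   for n odd.  For n = 1 both corrections fall on the same exponent, which gives
   L^(a_1 - 2).  Positions are counted from 0 below. *)
Definition cf_word (a : seq nat) : seq letter :=
  flatten [seq nseq (nth 0%N a i - (i == 0%N) - (i == (size a).-1))
                    (if odd i then R else L) | i <- iota 0 (size a)].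

(* Main.v *)
Require Import Defs.
From mathcomp Require Import all_boot all_order all_algebra.
From mathcomp Require Import zify ring lra.
Set Implicit Arguments.
Unset Strict Implicit.
Unset Printing Implicit Defensive.
Import Order.TTheory GRing.Theory Num.Theory.
Local Open Scope ring_scope.

(** Existence and uniqueness of the values of the partial actions are
separate matters.

For existence, write a rational point in primitive homogeneous coordinates
(p, r, q), standing for (p/q, r/q).  The mediant adds these vectors, and
[phi true], [phi false] act on them as the unimodular maps (p, r, q + r) and
(q, p, q + r), which preserve primitivity.  Hence every [phi_word w] commutes
with mediants ([mediant_phi_word]), and along each segment [theta S] turns
Farey mediants into mediants of points ([mediant_theta]).  Two computations
remain.

- On the points [phi_word w (1/2, 1/2)], the letter L appends 1 to w and I
  appends 0 ([act_word_phi_word_half]).  For I this is the mediant of (1/2, 1/2)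
  and (1, 0).  For L, one observes that [phi_word w (1/2, 1/2)] always has
  parameter 1/(m+2) on some segment, that appending a 1 changes the parameter to
  1/(m+3), and that the latter is the mediant of the former with its left
  parent 0/1.

- On a segment, L and R walk down the Farey tree.  If the Farey parents are
  l/m and r/s, the continuation coded by the continued fraction x ends at
  (l + r x)/(m + s x), or symmetrically when the word starts with R
  ([act_tail_word]).  The letter I leads from [phi_word omega (1/2, 1/2)] to
  parameter 1/2 on the segment of omega, whose parents are 0/1 and 1/1;
  this replaces the first of the a_1 steps L that would start from the
  improper pair 0/1, 1/0, whence the exponent a_1 - 1.

For uniqueness, [phi true] maps the part 1 > x >= y > 0 of the triangle into
x + y < 1 and [phi false] maps it into x + y >= 1, so images under distinct words
can be told apart ([phi_eq]).  This makes the segments disjoint ([theta_inj])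
and w a function of [phi_word w (1/2, 1/2)] ([phi_word_half_inj]); Farey
parents are unique by coprimality.

Finally, the representation factors through omega because a triangle sequence
of an interior point cannot end in 0 ([triangle_sequence_last_gt0]). *)

(** * Homogeneous coordinates and mediants *)

(** [(p, r, q)] are the homogeneous coordinates of [P] without common factor;
[q] is then the least common denominator of [P]. *)
Definition primitive_coords (P : point) (p r q : nat) : Prop :=
  [/\ (0 < q)%N, gcdn (gcdn p r) q = 1%N & P = (p%:R / q%:R, r%:R / q%:R)].

(** Any expression of [x] as a fraction is a multiple of the reduced one. *)
Lemma fraction_denom (p q : nat) (x : rat) :
  (0 < q)%N -> x = p%:R / q%:R ->
  exists n e, q = (`|denq x| * e)%N /\ p = (n * e)%N.
Proof.
move=> q0 xE.
have q0R : (q%:R : rat) != 0 by rewrite pnatr_eq0 -lt0n.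
have eqZ : (numq x * q%:Z = p%:Z * denq x)%R.
  apply: (@intr_inj rat); rewrite !rmorphM /=.
  have := divq_num_den x; rewrite {3}xE => /eqP.
  rewrite eqr_div // ?intr_eq0 ?denq_eq0 //.
  by move=> /eqP.
have eqN : (`|numq x| * q = p * `|denq x|)%N.
  by move/(congr1 absz): eqZ; rewrite !abszM.
have d0 : (0 < `|denq x|)%N by rewrite absz_gt0 denq_eq0.
have : (`|denq x| %| q)%N.
  rewrite -(@Gauss_dvdr _ `|numq x|); first by rewrite eqN dvdn_mull.
  by rewrite coprime_sym coprime_num_den.
case/dvdnP=> e qE; exists `|numq x|%N, e; split; first by rewrite mulnC.
by apply/eqP; rewrite -(eqn_pmul2r d0) -eqN qE mulnA.
Qed.

Lemma common_denomE (P : point) (p r q : nat) :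
  primitive_coords P p r q -> common_denom P = q.
Proof.
case=> q0 g1 PE.
have [n1 [e1 [q1 p1]]] : exists n e, q = (`|denq P.1| * e)%N /\ p = (n * e)%N.
  by apply: fraction_denom => //; rewrite PE.
have [n2 [e2 [q2 r2]]] : exists n e, q = (`|denq P.2| * e)%N /\ r = (n * e)%N.
  by apply: fraction_denom => //; rewrite PE.
(* [k] is the factor by which [q] exceeds the least common denominator; it
   divides all three coordinates. *)
have /dvdnP[k kE] : (common_denom P %| q)%N.
  by rewrite dvdn_lcm {1}q1 q2 !dvdn_mulr.
have kdvd x : forall d n e, (0 < d)%N -> (d %| common_denom P)%N ->
    q = (d * e)%N -> x = (n * e)%N -> (k %| x)%N.
  move=> d n e d0 /dvdnP[f fE] qe ->; apply: dvdn_mull.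
  apply/dvdnP; exists f; apply/eqP; rewrite -(eqn_pmul2l d0) -qe kE fE.
  by apply/eqP; ring.
have kp : (k %| p)%N.
  by apply: kdvd q1 p1; rewrite ?dvdn_lcml // absz_gt0 denq_eq0.
have kr : (k %| r)%N.
  by apply: kdvd q2 r2; rewrite ?dvdn_lcmr // absz_gt0 denq_eq0.
have : (k %| gcdn (gcdn p r) q)%N by rewrite !dvdn_gcd kp kr kE dvdn_mulr.
by rewrite g1 dvdn1 => /eqP k1; rewrite kE k1 mul1n.
Qed.

Lemma mediantE (P Q : point) (p r q p' r' q' : nat) :
  primitive_coords P p r q -> primitive_coords Q p' r' q' ->
  mediant P Q = ((p + p')%:R / (q + q')%:R, (r + r')%:R / (q + q')%:R).
Proof.
move=> hP hQ; rewrite /mediant (common_denomE hP) (common_denomE hQ).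
case: hP hQ => q0 _ -> [q0' _ ->] /=.
have nz : (q%:R : rat) != 0 by rewrite pnatr_eq0 -lt0n.
have nz' : (q'%:R : rat) != 0 by rewrite pnatr_eq0 -lt0n.
by rewrite !divfK // !natrD.
Qed.

Lemma phi_fraction (b : bool) (p r q : nat) : (0 < q)%N ->
  phi b (p%:R / q%:R, r%:R / q%:R) =
  ((if b then p else q)%:R / (q + r)%:R, (if b then r else p)%:R / (q + r)%:R).
Proof.
move=> q0; have nz : 0 < (q%:R : rat) by rewrite ltr0n.
have nr : 0 <= (r%:R : rat) by rewrite ler0n.
by rewrite /phi natrD; case: b => /=; congr pair; field;
  rewrite ?gt_eqF ?ltr_wpDr.
Qed.

Lemma phi_primitive (b : bool) (P : point) (p r q : nat) :
  primitive_coords P p r q ->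
  primitive_coords (phi b P) (if b then p else q) (if b then r else p) (q + r).
Proof.
case=> q0 g1 ->; split; [by rewrite addn_gt0 q0| |exact: phi_fraction].
apply/eqP; rewrite -dvdn1 -[in X in (_ %| X)%N]g1 !dvdn_gcd.
case: b.
  set g := gcdn _ _.
  have gp : (g %| p)%N := dvdn_trans (dvdn_gcdl _ _) (dvdn_gcdl _ _).
  have gr : (g %| r)%N := dvdn_trans (dvdn_gcdl _ _) (dvdn_gcdr _ _).
  by rewrite gp gr -(dvdn_addl q gr) dvdn_gcdr.
set g := gcdn _ _.
have gq : (g %| q)%N := dvdn_trans (dvdn_gcdl _ _) (dvdn_gcdl _ _).
have gp : (g %| p)%N := dvdn_trans (dvdn_gcdl _ _) (dvdn_gcdr _ _).
by rewrite gp gq -(dvdn_addr r gq) dvdn_gcdr.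
Qed.

Lemma phi_word_primitive (w : seq bool) (P : point) (p r q : nat) :
  primitive_coords P p r q ->
  exists p' r' q', primitive_coords (phi_word w P) p' r' q'.
Proof.
move=> hP; elim: w => [|b w [p' [r' [q' h]]]]; first by exists p, r, q.
by do 3!eexists; exact: phi_primitive h.
Qed.

(** The maps phi are linear in homogeneous coordinates and preserve primitivity,
hence commute with mediants. *)
Lemma mediant_phi_word (w : seq bool) (P Q : point) (p r q p' r' q' : nat) :
  primitive_coords P p r q -> primitive_coords Q p' r' q' ->
  mediant (phi_word w P) (phi_word w Q) = phi_word w (mediant P Q).
Proof.
move=> hP hQ; elim: w => //= b w <-.
have [x [y [z h]]] := phi_word_primitive w hP.
have [x' [y' [z' h']]] := phi_word_primitive w hQ.
rewrite (mediantE (phi_primitive b h) (phi_primitive b h')) (mediantE h h').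
rewrite phi_fraction; last by case: h => z0 _ _; rewrite addn_gt0 z0.
by rewrite addnACA; case: b.
Qed.

Lemma phi_word_cat (u v : seq bool) (P : point) :
  phi_word (u ++ v) P = phi_word u (phi_word v P).
Proof. exact: foldr_cat. Qed.

(** Along each segment, the mediant of points is the Farey mediant of the
parameters. *)
Lemma mediant_theta (S : segment) (a b c d : nat) :
  (0 < b)%N -> (0 < d)%N -> coprime a b -> coprime c d ->
  mediant (theta S (a%:R / b%:R)) (theta S (c%:R / d%:R)) =
  theta S ((a + c)%:R / (b + d)%:R).
Proof.
move=> b0 d0 /eqP ab /eqP cd.
have diag n m : (0 < m)%N -> gcdn n m = 1%N ->
    primitive_coords (n%:R / m%:R, n%:R / m%:R) n n m.
  by move=> m0 nm; split; rewrite // gcdnn.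
have horiz n m : (0 < m)%N -> gcdn n m = 1%N ->
    primitive_coords (n%:R / m%:R, 0) n 0 m.
  by move=> m0 nm; split; rewrite // ?gcdn0 // mul0r.
have vert n m : (0 < m)%N -> gcdn n m = 1%N ->
    primitive_coords (1, n%:R / m%:R) m n m.
  move=> m0 nm; split; rewrite // ?(gcdnC m) ?nm ?gcd1n //.
  by rewrite divff // pnatr_eq0 -lt0n.
case: S => [|||w] /=.
- by rewrite (mediantE (diag _ _ b0 ab) (diag _ _ d0 cd)).
- by rewrite (mediantE (horiz _ _ b0 ab) (horiz _ _ d0 cd)) addn0 mul0r.
- rewrite (mediantE (vert _ _ b0 ab) (vert _ _ d0 cd)) divff //.
  by rewrite pnatr_eq0 -lt0n addn_gt0 b0.
- rewrite /phi2 /=.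
  have cE t : phi_word w (phi true (phi false (t, 0))) =
      phi_word (w ++ [:: true; false]) (t, 0) by rewrite phi_word_cat.
  rewrite !cE.
  rewrite (mediant_phi_word _ (horiz _ _ b0 ab) (horiz _ _ d0 cd)).
  by rewrite (mediantE (horiz _ _ b0 ab) (horiz _ _ d0 cd)) addn0 mul0r.
Qed.

(** * Farey neighbours *)

(** [l / m < r / s] are neighbouring fractions of [[0, 1]] in the Farey sense.
The inequalities [l / m < r / s], [l < m] and [0 < r] follow from the
determinant equation together with [r <= s]. *)
Definition farey_pair (l m r s : nat) : Prop :=
  [/\ (0 < m)%N, (0 < s)%N, (r <= s)%N & (r * m = l * s + 1)%N].

Lemma farey_pair_coprime (l m r s : nat) : farey_pair l m r s ->
  [/\ coprime l m, coprime r s & coprime (l + r) (m + s)].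
Proof.
have cop a b c d : (a * b = c * d + 1)%N -> coprime a d.
  move=> e; rewrite /coprime -dvdn1.
  have h : (gcdn a d %| c * d + 1)%N by rewrite -e dvdn_mulr ?dvdn_gcdl.
  by rewrite -(@dvdn_addr (c * d)) // dvdn_mull ?dvdn_gcdr.
case=> m0 s0 rs e; split.
- by rewrite coprime_sym; apply: (@cop m r s); lia.
- by apply: (@cop r m l).
- by apply: (@cop (l + r) m l); lia.
Qed.

Lemma farey_pair_parents (l m r s : nat) : farey_pair l m r s ->
  farey_parents ((l + r)%:R / (m + s)%:R) (l%:R / m%:R) (r%:R / s%:R).
Proof.
move=> f; have [c1 c2 c3] := farey_pair_coprime f.
case: f => m0 s0 rs e; exists l, m, r, s; split=> //.
- split=> //; rewrite ltr_pdivrMr ?ltr0n // mulrAC ltr_pdivlMr ?ltr0n //.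
  by rewrite -!natrM ltr_nat; lia.
- by rewrite e addKn.
- rewrite -[(l + r)%:R]/((Posz (l + r))%:~R) -[(m + s)%:R]/((Posz (m + s))%:~R).
  rewrite coprimeq_num // coprimeq_den //=.
  have ms : (0 < m + s)%N by rewrite addn_gt0 m0.
  by rewrite gtr0_sg ?mul1r // ifF //; apply/eqP; lia.
Qed.

Lemma farey_pair_bounds (l m r s : nat) : farey_pair l m r s ->
  0 < ((l + r)%:R / (m + s)%:R : rat) < 1.
Proof.
case=> m0 s0 rs e; apply/andP; split.
  by rewrite divr_gt0 // ltr0n; nia.
by rewrite ltr_pdivrMr ?ltr0n ?mul1r ?ltr_nat; nia.
Qed.

Lemma farey_pair_left (l m r s : nat) :
  farey_pair l m r s -> farey_pair l m (l + r) (m + s).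
Proof. by case=> *; split; nia. Qed.

Lemma farey_pair_right (l m r s : nat) :
  farey_pair l m r s -> farey_pair (l + r) (m + s) r s.
Proof. by case=> *; split; nia. Qed.

Lemma farey_parents_unique (xi l r l' r' : rat) :
  farey_parents xi l r -> farey_parents xi l' r' -> l = l' /\ r = r'.
Proof.
case=> [a [b [c [d [[b0 d0 _ _] [-> -> _] e [n1 n2]]]]]].
case=> [a' [b' [c' [d' [[b0' d0' _ _] [-> -> _] e' [n1' n2']]]]]].
have en : (a + c = a' + c')%N by apply/eqP; rewrite -eqz_nat -n1 n1'.
have ed : (b + d = b' + d')%N by apply/eqP; rewrite -eqz_nat -n2 n2'.
have h : ((a + c) * b = a * (b + d) + 1)%N by lia.
have h' : ((a + c) * b' = a' * (b + d) + 1)%N by rewrite en ed; lia.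
(* [b] and [b'] both invert [a + c] modulo [b + d] and lie strictly between 0
   and [b + d], so they agree. *)
have cop : coprime (b + d) (a + c).
  rewrite /coprime -dvdn1 -(@dvdn_addr (a * (b + d))).
    by rewrite -h dvdn_mulr ?dvdn_gcdr.
  by rewrite dvdn_mull ?dvdn_gcdl.
have : (b = b' %[mod b + d])%N.
  have : ((a + c) * b = (a + c) * b' %[mod b + d])%N.
    by rewrite h h' !modnMDl.
  move: (b + d)%N (a + c)%N cop => n k cop /eqP.
  wlog le : b b' {b0 b0' e e' ed h h' n2 n2'} / (b <= b')%N.
    move=> W; case/orP: (leq_total b b') => le; first exact: W.
    by rewrite eq_sym => /W->.
  rewrite eq_sym eqn_mod_dvd ?leq_mul2l ?le ?orbT // -mulnBr Gauss_dvdr //.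
  by rewrite -eqn_mod_dvd // => /eqP.
rewrite !modn_small; [|lia..] => bb.
have dd : d = d' by lia.
have aa : a = a' by move: h h'; rewrite bb; nia.
have cc : c = c' by lia.
by rewrite aa bb cc dd.
Qed.

(** * Disjointness of the segments *)

(** The triangle without its sides [x = 1] and [y = 0], but with the open
diagonal side: a region that contains (1/2, 1/2), is stable under both maps phi,
and on which their images are disjoint. *)
Definition interior_or_diagonal (P : point) : bool :=
  [&& P.1 < 1, P.2 <= P.1 & 0 < P.2].

Lemma phi_interior (b : bool) (P : point) :
  triangle_interior P -> triangle_interior (phi b P).
Proof.
case: P b => x y [] /and3P[/= x1 yx y0]; have y1 : 0 < 1 + y by lra.
  by apply/and3P; split=> /=;
    rewrite ?ltr_pM2r ?divr_gt0 ?ltr_pdivrMr ?invr_gt0 //; lra.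
by apply/and3P; split=> /=;
  rewrite ?ltr_pM2r ?divr_gt0 ?ltr_pdivrMr ?invr_gt0 //; lra.
Qed.

Lemma phi_interior_or_diagonal (b : bool) (P : point) :
  interior_or_diagonal P -> interior_or_diagonal (phi b P).
Proof.
case: P b => x y [] /and3P[/= x1 yx y0]; have y1 : 0 < 1 + y by lra.
  by apply/and3P; split=> /=;
    rewrite ?ler_pM2r ?divr_gt0 ?ltr_pdivrMr ?invr_gt0 //; lra.
by apply/and3P; split=> /=;
  rewrite ?ler_pM2r ?divr_gt0 ?ltr_pdivrMr ?invr_gt0 //; lra.
Qed.

Lemma interior_interior_or_diagonal (P : point) :
  triangle_interior P -> interior_or_diagonal P.
Proof. by case/and3P=> x1 /ltW yx y0; apply/and3P. Qed.

Lemma phi_inj (b : bool) (P Q : point) :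
  interior_or_diagonal P -> interior_or_diagonal Q ->
  phi b P = phi b Q -> P = Q.
Proof.
case: P Q => x y [x' y'] /and3P[/= x1 yx y0] /and3P[/= x1' yx' y0'].
have nz : 1 + y != 0 by lra.
have nz' : 1 + y' != 0 by lra.
case: b => -[/eqP e1 /eqP e2]; move: e1 e2;
  rewrite !eqr_div // => /eqP e1 /eqP e2.
  have yy : y = y' by lra.
  by move: e1; rewrite yy => /(mulIf nz')->.
have yy : y = y' by lra.
by move: e2; rewrite yy => /(mulIf nz')->.
Qed.

Lemma phi_true_sum (P : point) : interior_or_diagonal P ->
  (phi true P).1 + (phi true P).2 < 1.
Proof.
by case: P => x y /and3P[/= *]; rewrite -mulrDl ltr_pdivrMr; lra.
Qed.

Lemma phi_false_sum (P : point) : interior_or_diagonal P ->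
  1 <= (phi false P).1 + (phi false P).2.
Proof.
by case: P => x y /and3P[/= *]; rewrite -mulrDl ler_pdivlMr; lra.
Qed.

(** Off the diagonal the inequality is strict, which separates the image from the
segment ell, where [x + y = 1]. *)
Lemma phi_false_sum_interior (P : point) : triangle_interior P ->
  1 < (phi false P).1 + (phi false P).2.
Proof.
by case: P => x y /and3P[/= *]; rewrite -mulrDl ltr_pdivlMr; lra.
Qed.

Lemma phi_eq (b b' : bool) (P Q : point) :
  interior_or_diagonal P -> interior_or_diagonal Q ->
  phi b P = phi b' Q -> b = b' /\ P = Q.
Proof.
move=> hP hQ e; have bb : b = b'.
  case: b b' e => [] [] // e.
    by have := phi_true_sum hP; rewrite e ltNge phi_false_sum.
  by have := phi_true_sum hQ; rewrite -e ltNge phi_false_sum.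
by subst b'; split=> //; apply: phi_inj e.
Qed.

Lemma phi_word_interior (w : seq bool) (P : point) :
  triangle_interior P -> triangle_interior (phi_word w P).
Proof. by move=> hP; elim: w => //= b w; apply: phi_interior. Qed.

Lemma phi_word_interior_or_diagonal (w : seq bool) (P : point) :
  interior_or_diagonal P -> interior_or_diagonal (phi_word w P).
Proof. by move=> hP; elim: w => //= b w; apply: phi_interior_or_diagonal. Qed.

(** The action of I is single-valued: the word is determined by the point. *)
Lemma phi_word_half_inj (w w' : seq bool) :
  phi_word w (1 / 2, 1 / 2) = phi_word w' (1 / 2, 1 / 2) -> w = w'.
Proof.
have hh : interior_or_diagonal (1 / 2, 1 / 2) by [].
have no b u : phi_word (b :: u) (1 / 2, 1 / 2) <> (1 / 2, 1 / 2).
  have := phi_word_interior_or_diagonal u hh; rewrite /=.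
  case: (phi_word u _) => x y h; case: b => e.
    by have := phi_true_sum h; rewrite e.
  case: e => e _; move: h => /and3P[/= *].
  have : 1 / (1 + y) * (1 + y) = 1 / 2 * (1 + y) by rewrite e.
  by rewrite divfK; lra.
elim: w w' => [|b w IH] [|b' w'] //.
- by move=> e; case: (no b' w').
- by move=> e; case: (no b w).
case/phi_eq; try exact: phi_word_interior_or_diagonal.
by move=> -> /IH->.
Qed.

(** This curve is the segment ell, on the line [x + y = 1]. *)
Lemma ell_param (xi : rat) : 0 < xi -> 
  phi true (phi false (phi2 (xi, xi))) = (1 / (1 + xi), xi / (1 + xi)).
Proof. by move=> x0; rewrite /phi /phi2 /=; congr pair; field; lra. Qed.

Lemma ell_interior (xi : rat) : 0 < xi < 1 ->
  triangle_interior (phi true (phi false (phi2 (xi, xi)))).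
Proof.
case/andP=> x0 x1; rewrite ell_param //; have y1 : 0 < 1 + xi by lra.
by apply/and3P; split=> /=;
  rewrite ?ltr_pM2r ?divr_gt0 ?ltr_pdivrMr ?invr_gt0 //; lra.
Qed.

Lemma theta_ell_inj (w w' : seq bool) (xi xi' : rat) :
  0 < xi < 1 -> 0 < xi' < 1 ->
  theta (SEll w) xi = theta (SEll w') xi' -> w = w' /\ xi = xi'.
Proof.
move=> hx hx'.
have no b u t t' : 0 < t < 1 -> 0 < t' < 1 ->
    theta (SEll (b :: u)) t <> theta (SEll [::]) t'.
  move=> ht ht'; have := phi_word_interior u (ell_interior ht).
  have sumE : (theta (SEll [::]) t').1 + (theta (SEll [::]) t').2 = 1.
    case/andP: ht' => t0 t1; rewrite [theta _ _]ell_param //= -mulrDl.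
    by rewrite divff //; lra.
  rewrite [theta (SEll (b :: u)) t]/(phi b (phi_word u _)).
  move=> h e; move: sumE; rewrite -e => sumE.
  case: b e sumE => e sumE.
    by have := phi_true_sum (interior_interior_or_diagonal h); rewrite sumE.
  by have := phi_false_sum_interior h; rewrite sumE.
elim: w w' => [|b w IH] [|b' w'].
- move=> e; split=> //; move: e; case/andP: hx => x0 x1.
  case/andP: hx' => x0' x1'.
  rewrite [theta _ _]ell_param // [theta _ _]ell_param //.
  by move=> [/eqP + _]; rewrite eqr_div; [move/eqP; lra|lra..].
- by move=> e; case: (no b' w' _ _ hx' hx).
- by move=> e; case: (no b w _ _ hx hx').
- case/phi_eq; try exact: interior_interior_or_diagonal (phi_word_interior _ (ell_interior _)).
  by move=> -> /IH[-> ->].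
Qed.

(** The open segments are pairwise disjoint and injectively parametrized. *)
Lemma theta_inj (S S' : segment) (xi xi' : rat) :
  0 < xi < 1 -> 0 < xi' < 1 -> theta S xi = theta S' xi' -> S = S' /\ xi = xi'.
Proof.
have int w t : 0 < t < 1 -> triangle_interior (theta (SEll w) t).
  by move=> ht; apply: phi_word_interior; apply: ell_interior.
move=> hx hx'; case/andP: (hx) => x0 x1; case/andP: (hx') => x0' x1'.
case: S => [|||w]; case: S' => [|||w'] e;
  try (by case/theta_ell_inj: e => // -> ->);
  try (by have := int w _ hx; rewrite e => /and3P[/= *]; exfalso; lra);
  try (by have := int w' _ hx'; rewrite -e => /and3P[/= *]; exfalso; lra);
  by case: e => *; first [by split | exfalso; lra].
Qed.

(** * The right actions *)

Lemma act_functional (X Y Y' : point) (c : letter) :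
  act X c Y -> act X c Y' -> Y = Y'.
Proof.
have par A B A' B' : parents X A B -> parents X A' B' -> A = A' /\ B = B'.
  case=> [S [xi [l [r [hx XE f -> ->]]]]] [S' [xi' [l' [r' [hx' XE' f' -> ->]]]]].
  have [SS xx] : S = S' /\ xi = xi' by apply: theta_inj; rewrite -?XE.
  subst S' xi'; have [-> ->] := farey_parents_unique f f'.
  by [].
case: c => /=.
- by move=> [A [B [h ->]]] [A' [B' [h' ->]]]; have [-> _] := par _ _ _ _ h h'.
- by move=> [A [B [h ->]]] [A' [B' [h' ->]]]; have [_ ->] := par _ _ _ _ h h'.
- by move=> [w -> ->] [w' /phi_word_half_inj-> ->].
Qed.

Lemma act_word_functional (X Y Y' : point) (w : seq letter) :
  act_word X w Y -> act_word X w Y' -> Y = Y'.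
Proof.
elim: w X => [|c w IH] X /=; first by move=> -> ->.
move=> [Z aZ wZ] [Z' aZ' wZ']; apply: (IH Z) => //.
by rewrite (act_functional aZ aZ').
Qed.

Lemma act_word_eqI (X Y : point) (w : seq letter) :
  act_word X w Y -> act_word_eq X w Y.
Proof. by move=> h Z; split=> [h'|->//]; apply: act_word_functional h' h. Qed.

Lemma act_word_cat (X Y Z : point) (u v : seq letter) :
  act_word X u Y -> act_word Y v Z -> act_word X (u ++ v) Z.
Proof.
elim: u X => [|c u IH] X /=; first by move=> ->.
by move=> [X' a1 a2] a3; exists X' => //; apply: IH a3.
Qed.

Lemma act_theta_L (S : segment) (l m r s : nat) : farey_pair l m r s ->
  act (theta S ((l + r)%:R / (m + s)%:R)) L
      (theta S ((l + (l + r))%:R / (m + (m + s))%:R)).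
Proof.
move=> f; exists (theta S (l%:R / m%:R)), (theta S (r%:R / s%:R)); split.
  exists S, ((l + r)%:R / (m + s)%:R), (l%:R / m%:R), (r%:R / s%:R); split=> //.
    exact: farey_pair_bounds.
  exact: farey_pair_parents.
have [c1 c2 c3] := farey_pair_coprime f; case: f => m0 s0 _ _.
rewrite mediant_theta ?addn_gt0 ?m0 //.
by rewrite (addnC (l + r)) (addnC (m + s)).
Qed.

Lemma act_theta_R (S : segment) (l m r s : nat) : farey_pair l m r s ->
  act (theta S ((l + r)%:R / (m + s)%:R)) R
      (theta S (((l + r) + r)%:R / ((m + s) + s)%:R)).
Proof.
move=> f; exists (theta S (l%:R / m%:R)), (theta S (r%:R / s%:R)); split.
  exists S, ((l + r)%:R / (m + s)%:R), (l%:R / m%:R), (r%:R / s%:R); split=> //.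
    exact: farey_pair_bounds.
  exact: farey_pair_parents.
have [c1 c2 c3] := farey_pair_coprime f; case: f => m0 s0 _ _.
by rewrite mediant_theta ?addn_gt0 ?m0.
Qed.

(** Prolonging a word by ones moves the image of (1/2, 1/2) along one fixed
segment, towards its left end: along Sigma if the word has only ones, and
along [phi_word v ell] if its last 0 comes right after [v]. *)
Lemma phi_word_half_theta (w : seq bool) : exists S m, forall k,
  phi_word (w ++ nseq k true) (1 / 2, 1 / 2) = theta S (1 / (m + k).+2%:R).
Proof.
have pow k : phi_word (nseq k true) (1 / 2, 1 / 2) =
    (1 / k.+2%:R, 1 / k.+2%:R).
  elim: k => //= k ->; rewrite /phi /=.
  have k0 : (0 : rat) <= k%:R by rewrite ler0n.
  by rewrite -!natr1; congr pair; field; lra.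
elim/last_ind: w => [|w [] IH].
- by exists SSigma, 0%N => k; rewrite cat0s pow.
- case: IH => S [m IH]; exists S, m.+1 => k.
  by rewrite cat_rcons -[true :: _]/(nseq k.+1 true) IH addnS.
(* Here [phi false (x, x)] is the point of parameter [x] on ell. *)
- exists (SEll w), 0%N => k.
  rewrite cat_rcons phi_word_cat /= pow add0n; congr phi_word.
  have k0 : (0 : rat) <= k%:R by rewrite ler0n.
  by rewrite -!natr1 /phi /phi2 /=; congr pair; field; lra.
Qed.

Lemma act_phi_word_half_L (w : seq bool) :
  act (phi_word w (1 / 2, 1 / 2)) L (phi_word (rcons w true) (1 / 2, 1 / 2)).
Proof.
have [S [m h]] := phi_word_half_theta w.
have := h 0%N; have := h 1%N; rewrite cats0 cats1 => -> ->.
have f : farey_pair 0 1 1 m.+1 by split; lia.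
by have := act_theta_L S f; rewrite !add0n !add1n addn0 addn1.
Qed.

Lemma mediant_half_vertex (w : seq bool) :
  mediant (phi_word w (1 / 2, 1 / 2)) (phi_word w (1, 0)) =
  phi_word w (2 / 3, 1 / 3).
Proof.
have h1 : primitive_coords (1 / 2, 1 / 2) 1 1 2 by [].
have h2 : primitive_coords (1, 0) 1 0 1 by [].
by rewrite (mediant_phi_word _ h1 h2) (mediantE h1 h2).
Qed.

Lemma act_phi_word_half_I (w : seq bool) :
  act (phi_word w (1 / 2, 1 / 2)) I (phi_word w (2 / 3, 1 / 3)).
Proof. by exists w => //; rewrite mediant_half_vertex. Qed.

(** L and I append 1 and 0 to the word. *)
Lemma act_word_phi_word_half (w u : seq bool) :
  act_word (phi_word w (1 / 2, 1 / 2)) [seq if b then L else I | b <- u]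
           (phi_word (w ++ u) (1 / 2, 1 / 2)).
Proof.
elim: u w => [|b u IH] w /=; first by rewrite cats0.
exists (phi_word (rcons w b) (1 / 2, 1 / 2)); last by rewrite -cat_rcons.
case: b; first exact: act_phi_word_half_L.
have -> : phi_word (rcons w false) (1 / 2, 1 / 2) = phi_word w (2 / 3, 1 / 3).
  by rewrite -cats1 phi_word_cat.
exact: act_phi_word_half_I.
Qed.

(** * Continued fractions *)

(** The word C^(m_0) C'^(m_1) C^(m_2) ... for [a = [:: m_0; m_1; ...]], with
alternating letters C, C' and the last exponent lowered by 1; C is R if [d]
holds and L otherwise. *)
Fixpoint tail_word (d : bool) (a : seq nat) : seq letter :=
  match a with
  | [::] => [::]
  | [:: m] => nseq m.-1 (if d then R else L)
  | m :: s => nseq m (if d then R else L) ++ tail_word (~~ d) s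
  end.

Lemma tail_wordE (d : bool) (a : seq nat) :
  flatten [seq nseq (nth 0%N a i - (i == (size a).-1))
                    (if odd i (+) d then R else L) | i <- iota 0 (size a)]
  = tail_word d a.
Proof.
elim: a d => [|m [|m' s] IH] d //; first by rewrite /= cats0 subn1.
rewrite [RHS]/(_ ++ tail_word (~~ d) (m' :: s)) -IH.
rewrite [size (m :: _)]/= -[iota 0 _.+2]/(0%N :: iota 1 (size s).+1) /=.
rewrite subn0; congr cat; congr cat.
rewrite (iotaDl 1 1) -map_comp; congr flatten; apply: eq_map => i /=.
by rewrite add1n /= addbN addNb.
Qed.

(** Lowering the first entry by 1 yields the exponent [a_1 - 1], and [a_1 - 2]
when that entry is also the last. *)
Lemma cf_wordE (m : nat) (s : seq nat) :
  cf_word (m :: s) = tail_word false (m.-1 :: s).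
Proof.
rewrite -tail_wordE /cf_word /= subn1; congr cat.
rewrite (iotaDl 1 0) -!map_comp; congr flatten; apply: eq_map => i /=.
by rewrite add1n /= addbF subn0.
Qed.

Lemma cf_value_cons (m : nat) (s : seq nat) :
  cf_value (m :: s) = (m%:R + cf_value s)^-1.
Proof. exact: div1r. Qed.

Lemma cf_value_gt0 (a : seq nat) :
  (0 < size a)%N -> (0 < last 0%N a)%N -> 0 < cf_value a.
Proof.
elim: a => [|m [|m' s] IH] // _ /= h.
  by rewrite addr0 divr_gt0 // ltr0n.
by rewrite divr_gt0 // ltr_wpDl ?ler0n //; apply: IH.
Qed.

Lemma act_word_nseq_L (S : segment) (k l m r s : nat) : farey_pair l m r s ->
  farey_pair l m (k * l + r) (k * m + s) /\
  act_word (theta S ((l + r)%:R / (m + s)%:R)) (nseq k L)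
           (theta S ((l + (k * l + r))%:R / (m + (k * m + s))%:R)).
Proof.
elim: k r s => [|k IH] r s f //=.
have [f' h] := IH _ _ (farey_pair_left f).
rewrite !mulSnr -!addnA; split=> //.
by eexists; [exact: act_theta_L f|].
Qed.

Lemma act_word_nseq_R (S : segment) (k l m r s : nat) : farey_pair l m r s ->
  farey_pair (l + k * r) (m + k * s) r s /\
  act_word (theta S ((l + r)%:R / (m + s)%:R)) (nseq k R)
           (theta S ((l + k * r + r)%:R / (m + k * s + s)%:R)).
Proof.
elim: k l m => [|k IH] l m f /=; first by rewrite !addn0.
have [f' h] := IH _ _ (farey_pair_right f).
rewrite !mulSn !addnA; split=> //.
by eexists; [exact: act_theta_R f|].
Qed.

(** The walk down the Farey tree coded by [a], started at the mediant of l/m and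
r/s: by induction, since [k] steps in the direction of l/m replace r/s by
(kl + r)/(km + s), which matches [cf_value (k :: a) = 1 / (k + cf_value a)].
Zero entries are allowed except in the last place. *)
Lemma act_tail_word (S : segment) (d : bool) (a : seq nat) (l m r s : nat) :
  (0 < size a)%N -> (0 < last 0%N a)%N -> farey_pair l m r s ->
  act_word (theta S ((l + r)%:R / (m + s)%:R)) (tail_word d a)
    (theta S (if d then (l%:R * cf_value a + r%:R) / (m%:R * cf_value a + s%:R)
              else (l%:R + r%:R * cf_value a) / (m%:R + s%:R * cf_value a))).
Proof.
elim: a d l m r s => [|k [|k' t] IH] d l m r s // _ h f.
  case: k h => // k _; rewrite cf_value_cons addr0 /=.
  have k0 : (0 : rat) <= k%:R by rewrite ler0n.
  have [m0 s0] : 0 < (m%:R : rat) /\ 0 < (s%:R : rat).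
    by case: f => m0 s0 _ _; rewrite !ltr0n.
  have mk : 0 <= k%:R * (m%:R : rat) by rewrite mulr_ge0 // ltW.
  have sk : 0 <= k%:R * (s%:R : rat) by rewrite mulr_ge0 // ltW.
  case: d => /=.
    have [_] := act_word_nseq_R S k f.
    congr act_word; congr theta.
    by rewrite -natr1 !natrD !natrM; field; nra.
  have [_] := act_word_nseq_L S k f.
  congr act_word; congr theta.
  by rewrite -natr1 !natrD !natrM; field; nra.
have c0 : 0 < cf_value (k' :: t) by apply: cf_value_gt0.
rewrite cf_value_cons.
move: (cf_value (k' :: t)) c0 (fun e => IH e) => x x0 {}IH.
have k0 : (0 : rat) <= k%:R by rewrite ler0n.
have [m0 s0] : 0 < (m%:R : rat) /\ 0 < (s%:R : rat).
  by case: f => m0 s0 _ _; rewrite !ltr0n.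
rewrite [tail_word _ _]/(nseq k _ ++ tail_word (~~ d) (k' :: t)).
case: d => /=.
  have [f' h'] := act_word_nseq_R S k f; apply: act_word_cat h' _.
  have := IH false _ _ _ _ isT h f'.
  congr act_word; congr theta.
  by rewrite !natrD !natrM; field; nra.
have [f' h'] := act_word_nseq_L S k f; apply: act_word_cat h' _.
have := IH true _ _ _ _ isT h f'.
congr act_word; congr theta.
by rewrite !natrD !natrM; field; nra.
Qed.

Lemma act_cf_word (S : segment) (xi : rat) (a : seq nat) :
  0 < xi < 1 -> continued_fraction xi a ->
  act_word (theta S (1 / 2)) (cf_word a) (theta S xi).
Proof.
move=> /andP[x0 x1] [a0 apos alast xE]; case: a a0 apos alast xE => // k t _ /=.
case/andP=> k0 tpos tlast xE; rewrite cf_wordE.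
have lt : (0 < last k.-1 t)%N.
  case: t tpos tlast xE => [_ _|k' t _ h _] /=; last exact: ltnW (h isT).
  rewrite addr0 => xE; move: x1; rewrite xE ltr_pdivrMr ?ltr0n // mul1r.
  by rewrite (ltr_nat _ 1 k); lia.
have f : farey_pair 0 1 1 1 by [].
(* With [x] the value of [k.-1 :: t], the walk from (0/1, 1/1) ends at
   x / (1 + x) = 1 / (k + cf_value t). *)
have := @act_tail_word S false (k.-1 :: t) _ _ _ _ isT lt f.
congr act_word; congr theta; rewrite xE !cf_value_cons add0r !mul1r.
have y0 : 0 <= cf_value t.
  case: t tlast {tpos xE f} lt => // k' t _ lt.
  exact/ltW/cf_value_gt0.
have [j kE] : exists j, k = j.+1 by exists k.-1; rewrite prednK.
have nz : 0 < (j%:R : rat) + cf_value t.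
  have := @cf_value_gt0 (k.-1 :: t) isT lt.
  by rewrite cf_value_cons kE invr_gt0.
by rewrite kE /= -natr1; field; lra.
Qed.

(** * The last entry of a triangle sequence *)

(** If the last entry were 0, the last point before Lambda would be on [x = 1],
hence its predecessor on [x = y]; but [x = y] is not reached by the triangle
map from a point of the triangle, since [1 - x - k * y] is less than [y] for a
point of index [k].  So the starting point would be on one of those sides. *)
Lemma triangle_sequence_last_gt0 (P : point) (alpha : seq nat) :
  triangle_interior P -> triangle_sequence P alpha -> (0 < last 0%N alpha)%N.
Proof.
move=> /and3P[P1 P21 P2] [a0 part lam].
case/lastP: alpha a0 part lam => // s m _ part; rewrite last_rcons size_rcons.
case: m part => // part /=; set Q := iter (size s) triangle_map P.
have partQ : triangle_part 0 Q.
  have := part (size s); rewrite size_rcons nth_rcons ltnn eqxx.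
  by apply.
have tQ : triangle Q by case/and3P: partQ.
have idxQ : triangle_index Q = 0%N by apply/eqP; rewrite -triangle_partE.
case/and3P=> _ _; rewrite /triangle_map idxQ /= mul0r subr0 => lam.
have Q1 : Q.1 = 1.
  have nz : Q.1 != 0 by case/and3P: tQ => *; lra.
  by move: lam; rewrite mulf_eq0 invr_eq0 (negPf nz) orbF => /eqP; lra.
move: Q1; clear partQ tQ idxQ lam; rewrite {}/Q.
have partj j : (j < size s)%N ->
    triangle_part (nth 0%N s j) (iter j triangle_map P).
  by move=> js; have := part j; rewrite size_rcons nth_rcons js; apply; lia.
case: (size s) partj => [|n] {part} partj /=; first by move=> e; exfalso; lra.
set Q := iter n triangle_map P => Q1.
have diagQ : Q.1 = Q.2.
  have /and3P[tQ _ _] := partj n (ltnSn n).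
  have nz : Q.1 != 0 by case/and3P: tQ => *; rewrite /Q; lra.
  by rewrite -[RHS](divfK nz) Q1 mul1r.
move: diagQ; clear Q1; rewrite {}/Q; case: n partj => [|n] partj /=.
  by move=> e; exfalso; lra.
have pQ := partj n (leqnSn n.+1).
set Q := iter n triangle_map P in pQ * => e.
have tQ : triangle Q by case/and3P: pQ.
have idx : triangle_index Q = nth 0%N s n by apply/eqP; rewrite -triangle_partE.
have nz : Q.1 != 0 by case/and3P: (tQ) => *; lra.
have /(mulIf (invr_neq0 nz)) := e; rewrite idx => e'.
by case/and3P: pQ => _ _; rewrite -natr1; lra.
Qed.

(** * Words and the segment of a triangle sequence *)

Lemma full_word_prefix (T : Type) (x y : T) (s : seq nat) :
  (0 < last 0%N s)%N -> full_word x y s = prefix_word x y s ++ [:: x; y].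
Proof.
case/lastP: s => // s m; rewrite last_rcons => m0.
rewrite /prefix_word size_rcons last_rcons -cats1 take_size_cat //.
rewrite /full_word map_cat flatten_cat /= cats0 -catA; congr cat.
by rewrite -[in LHS](prednK m0) -addn1 nseqD -cats1 -catA.
Qed.

Lemma prefix_word_map (T U : Type) (f : T -> U) (x y : T) (s : seq nat) :
  map f (prefix_word x y s) = prefix_word (f x) (f y) s.
Proof.
rewrite /prefix_word map_cat map_nseq /full_word map_flatten -map_comp.
by congr (flatten _ ++ _); apply: eq_map => m /=; rewrite map_rcons map_nseq.
Qed.

Lemma ell_phi (xi : rat) : 0 < xi < 1 ->
  ell (phi true (phi false (phi2 (xi, xi)))).
Proof.
case/andP=> x0 x1; have y0 : 0 < 1 + xi by lra.
exists (2 * xi / (1 + xi)).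
  apply/andP; split; first by rewrite divr_gt0 //; lra.
  by rewrite ltr_pdivrMr //; lra.
by rewrite ell_param //; congr pair; field; lra.
Qed.

Theorem theorem6p6 (P : point) (alpha a : seq nat) (omega : seq bool)
    (intP : triangle_interior P)
    (reprP : representation P alpha a)
    (omegaE : omega = prefix_word true false alpha) :
  [/\ (exists2 Q, ell Q & P = phi_word omega Q),
      act_word_eq (1 / 2, 1 / 2) (prefix_word L I alpha)
        (phi_word omega (1 / 2, 1 / 2)),
      act_word_eq (phi_word omega (1 / 2, 1 / 2)) (I :: cf_word a) P
    & act_word_eq (1 / 2, 1 / 2) (prefix_word L I alpha ++ I :: cf_word a) P].
Proof.
case: reprP => seqP [xi [hxi PE cf]].
have last0 := triangle_sequence_last_gt0 intP seqP.
have {}PE : P = theta (SEll omega) xi.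
  by rewrite PE full_word_prefix // -omegaE phi_word_cat.
have act1 : act_word (1 / 2, 1 / 2) (prefix_word L I alpha)
    (phi_word omega (1 / 2, 1 / 2)).
  have := act_word_phi_word_half [::] omega.
  by rewrite {1}omegaE prefix_word_map.
have act2 : act_word (phi_word omega (1 / 2, 1 / 2)) (I :: cf_word a) P.
  exists (phi_word omega (2 / 3, 1 / 3)); first exact: act_phi_word_half_I.
  by rewrite PE; apply: act_cf_word.
split; try apply: act_word_eqI => //.
  exists (phi true (phi false (phi2 (xi, xi)))) => //; exact: ell_phi.
exact: act_word_cat act1 act2.
Qed.
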